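(* Let $\mathcal A$ and $\mathcal B$ be unital Banach algebras, let $c \in \mathcal A$ and $d \in \mathcal B$ be fixed elements with $d$ invertible, and let $\phi: \mathcal A \to \mathcal B$ be a bijective linear map such that $\phi(a)\phi(b) = d$ whenever $a, b \in \mathcal A$ satisfy $ab = c$. Put $z = \phi(1)$. Then (1) $\phi(x^{-1}) = z\phi(x)^{-1}z$ for all invertible $x \in \mathcal A$; (2) $z^{-1}\phi$ strongly preserves invertibility; (3) $z^{-1}\phi$ is a Jordan homomorphism; and (4) if $\mathcal B$ is prime, then $z^{-1}\phi$ is either a homomorphism or an antihomomorphism.
   Context: Banach algebras are complex and associative. The map $z^{-1}\phi$ is $x \mapsto z^{-1}\phi(x)$. A map $\psi: \mathcal A \to \mathcal B$ strongly preserves invertibility if $\psi(x^{-1}) = \psi(x)^{-1}$ for all invertible $x \in \mathcal A$. A Jordan homomorphism $\psi: \mathcal A \to \mathcal B$ is a linear map such that $\psi(a^2) = \psi(a)^2$ for all $a \in \mathcal A$. A ring is called prime if the product of any two nonzero ideals is nonzero. The inverses appearing in the claim ($z^{-1}$ and $\phi(x)^{-1}$ for invertible $x$) are part of what is asserted to exist. Continuity of $\phi$ is not assumed. *)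

(* Defs.v *)
From HB Require Import structures.
From mathcomp Require Import all_boot all_order all_algebra.
From mathcomp Require Import all_classical all_reals all_analysis.
From mathcomp Require Import complex.

Set Implicit Arguments.
Unset Strict Implicit.
Unset Printing Implicit Defensive.

Import Order.TTheory GRing.Theory Num.Theory.
Import numFieldNormedType.Exports.

Local Open Scope classical_set_scope.
Local Open Scope ring_scope.

(* MathComp's [NormedModule] and [UnitRing] hierarchies have no common
   substructure below [numDomainType], so that HB rejects their join. The ring
   operations are therefore given over a [completeNormedModType], and the
   [unitAlgType] structure is derived from them below. The normalization
   [`|1| = 1] is not required. *)
HB.mixin Record isUnitalBanachAlgebra (K : numFieldType) A
    of CompleteNormedModule K A := {
  ba_one : A;
  ba_mul : A -> A -> A;
  ba_mulA : associative ba_mul;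
  ba_mul1x : left_id ba_one ba_mul;
  ba_mulx1 : right_id ba_one ba_mul;
  ba_mulDl : left_distributive ba_mul +%R;
  ba_mulDr : right_distributive ba_mul +%R;
  ba_one_neq0 : ba_one != 0;
  ba_scaleAl : forall (k : K) (x y : A), k *: ba_mul x y = ba_mul (k *: x) y;
  ba_scaleAr : forall (k : K) (x y : A), k *: ba_mul x y = ba_mul x (k *: y);
  ba_norm_mul : forall x y : A, `|ba_mul x y| <= `|x| * `|y|
}.

#[short(type="unitalBanachAlgType")]
HB.structure Definition UnitalBanachAlgebra (K : numFieldType) :=
  {A of CompleteNormedModule K A & isUnitalBanachAlgebra K A}.

Section UnitalBanachAlgebraTheory.
Context {K : numFieldType} {A : unitalBanachAlgType K}.

HB.instance Definition _ := GRing.Zmodule_isNzRing.Build A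
  (@ba_mulA K A) (@ba_mul1x K A) (@ba_mulx1 K A) (@ba_mulDl K A)
  (@ba_mulDr K A) (@ba_one_neq0 K A).

HB.instance Definition _ :=
  GRing.Lmodule_isLalgebra.Build K A (@ba_scaleAl K A).

HB.instance Definition _ := GRing.Lalgebra_isAlgebra.Build K A (@ba_scaleAr K A).

Definition two_sided_inverse (x : A) : set A := [set y | y * x = 1 /\ x * y = 1].

Definition ba_unit : pred A := fun x => `[< exists y, two_sided_inverse x y >].

(* [xget x P] is an element of [P], or [x] when [P] is empty. *)
Definition ba_inv (x : A) : A := xget x (two_sided_inverse x).

Lemma ba_invP x : x \in ba_unit -> two_sided_inverse x (ba_inv x).
Proof. by move=> /asboolP[y xy]; rewrite /ba_inv; case: xgetP => // /(_ y). Qed.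

Lemma ba_mulVx : {in ba_unit, left_inverse 1 ba_inv *%R}.
Proof. by move=> x /ba_invP[]. Qed.

Lemma ba_mulxV : {in ba_unit, right_inverse 1 ba_inv *%R}.
Proof. by move=> x /ba_invP[]. Qed.

Lemma ba_unitP x y : y * x = 1 /\ x * y = 1 -> ba_unit x.
Proof. by move=> xy; apply/asboolP; exists y. Qed.

Lemma ba_inv_out : {in [predC ba_unit], ba_inv =1 id}.
Proof.
move=> x /negP nx; rewrite /ba_inv; case: xgetP => // y _ xy.
by case: nx; apply/asboolP; exists y.
Qed.

HB.instance Definition _ := GRing.NzRing_hasMulInverse.Build A
  ba_mulVx ba_mulxV ba_unitP ba_inv_out.

Lemma normrM_le (x y : A) : `|x * y| <= `|x| * `|y|.
Proof. exact: ba_norm_mul. Qed.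

End UnitalBanachAlgebraTheory.

Section Ideals.
Context {S : pzRingType}.

Definition two_sided_ideal (I : set S) : Prop :=
  [/\ I 0, forall x y, I x -> I y -> I (x - y),
      forall r x, I x -> I (r * x) & forall r x, I x -> I (x * r)].

Definition ideal_product (I J : set S) : set S :=
  [set x | exists (n : nat) (a b : 'I_n -> S),
     [/\ forall i, I (a i), forall i, J (b i) & x = \sum_(i < n) a i * b i]].

End Ideals.

Definition prime_ring (S : pzRingType) : Prop :=
  forall I J : set S, two_sided_ideal I -> two_sided_ideal J ->
    I <> [set 0] -> J <> [set 0] -> ideal_product I J <> [set 0].

Section Maps.
Context {K : unitRingType} {A B : unitAlgType K}.
Implicit Type psi : A -> B.

Definition strongly_preserves_invertibility psi : Prop :=
  forall x, x \is a GRing.unit ->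
    psi x \is a GRing.unit /\ psi x^-1 = (psi x)^-1.

Definition jordan_homomorphism psi : Prop :=
  linear psi /\ forall a, psi (a ^+ 2) = psi a ^+ 2.

Definition algebra_homomorphism psi : Prop :=
  linear psi /\ forall a b, psi (a * b) = psi a * psi b.

Definition algebra_antihomomorphism psi : Prop :=
  linear psi /\ forall a b, psi (a * b) = psi b * psi a.

End Maps.

(* Main.v *)
From HB Require Import structures.
Require Import Defs.
From mathcomp Require Import all_boot all_order all_algebra.
From mathcomp Require Import all_classical all_reals all_analysis.
From mathcomp Require Import complex.
Import Order.TTheory GRing.Theory Num.Theory.
Import numFieldNormedType.Exports.
Local Open Scope ring_scope.
Set Implicit Arguments.
Unset Strict Implicit.

(** If [x] is invertible, then [x * (x^-1 * c) = c] and [(c * x^-1) * x = c]: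
    these two factorizations of [c] give [phi x] a right and a left inverse, so
    [phi x] is invertible and [phi (x^-1 * c) = (phi x)^-1 * d].  Put
    [f x = z^-1 * phi x] and [g y = phi (y * c) * d^-1 * z].  These are two
    linear maps, [f 1 = 1], and [g x^-1 = (f x)^-1] for every invertible [x].

    Even before one knows that [f] and [g] agree, such a pair forces [f] to
    respect squares.  When [a] and [b = a + k] are invertible for a scalar
    [k != 0], the resolvent identity [a^-1 - b^-1 = k (b a)^-1] is sent by [g] to
    [(f a)^-1 - (f b)^-1 = k (f (b a))^-1], while the same identity in [B]
    gives [(f a)^-1 - (f b)^-1 = k (f b * f a)^-1].  Hence
    [f (b a) = f b * f a], which amounts to [f (a ^+ 2) = f a ^+ 2]
    ([inv_preserving_sqr]).  This is an exact algebraic identity, with no limit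
    in it.  Completeness enters only through the Neumann series: [a + k] is
    invertible for all large scalars [k] ([add_scalar_unit]), and since the
    property of [a + k] implies that of [a] ([sqr_shift]), [f] is a Jordan
    homomorphism.

    A Jordan homomorphism satisfies [f (a b a) = f a * f b * f a]; taking
    [b = a^-1] shows that [f] preserves inverses, and the formula for
    [phi x^-1] is a rewriting of this.

    For prime [B], the defects [P = f (a b) - f a * f b] and
    [Q = f (a b) - f b * f a] satisfy [P t Q + Q t P = 0] for every [t] in the
    range of [f], which is all of [B]; primeness then makes one of them vanish.
    So for each pair [(a, b)] one of the two multiplication rules holds, and
    the choice is uniform because an additive group is not the union of two
    proper subgroups ([jordan_prime]). *)

(** * Jordan homomorphisms of rings *)

Section JordanMaps.
Variables (S T : pzRingType) (f : {additive S -> T}).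
Hypothesis T_2free : forall x : T, x *+ 2 = 0 -> x = 0.
Hypothesis f_sqr : forall a, f (a ^+ 2) = f a ^+ 2.

Lemma jordan_sym a b : f (a * b + b * a) = f a * f b + f b * f a.
Proof.
have := f_sqr (a + b).
rewrite raddfD !expr2 !mulrDl !mulrDr !raddfD /= -!expr2 !f_sqr !addrA.
by move=> /addIr; rewrite -!addrA => /addrI.
Qed.

(** This expresses [a * b * a] through squares and symmetrized products, the
    only operations that a Jordan homomorphism is known to respect. *)
Lemma jordan_triple_identity (U : pzRingType) (a b : U) :
  a * (a * b + b * a) + (a * b + b * a) * a
  = (a ^+ 2 * b + b * a ^+ 2) + (a * b * a) *+ 2.
Proof.
rewrite mulrDl mulrDr mulr2n expr2 !mulrA -!addrA; congr (_ + _).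
by rewrite addrCA addrA addrC.
Qed.

Lemma jordan_triple a b : f (a * b * a) = f a * f b * f a.
Proof.
apply/eqP; rewrite -subr_eq0; apply/eqP/T_2free.
rewrite mulrnBl; apply/eqP; rewrite subr_eq0 -raddfMn; apply/eqP.
apply: (@addrI _ (f (a ^+ 2 * b + b * a ^+ 2))).
rewrite -raddfD -jordan_triple_identity (jordan_sym a) (jordan_sym a b).
by rewrite jordan_triple_identity jordan_sym f_sqr.
Qed.

(** Linearization in the outer variable of the formula for [f (a * b * a)]. *)
Lemma jordan_triple_sym a b c :
  f (a * b * c + c * b * a) = f a * f b * f c + f c * f b * f a.
Proof.
have := jordan_triple (a + c) b.
rewrite !raddfD /= !mulrDl !mulrDr !raddfD /= !jordan_triple.
by rewrite -!addrA => /addrI; rewrite !addrA => /addIr.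
Qed.

(** The element [a b r b a + b a r a b] is a symmetrized triple product of
    [a b], [r], [b a], and also a sum of two nested products [a (b r b) a] and
    [b (a r a) b].  The claim is the equality of the two resulting values of
    [f], after [f (b a)] is eliminated by
    [f (a b) + f (b a) = f a * f b + f b * f a]. *)
Lemma jordan_defects_anticommute a b r :
  let P := f (a * b) - f a * f b in
  let Q := f (a * b) - f b * f a in
  P * f r * Q + Q * f r * P = 0.
Proof.
move=> P Q.
pose u := f (a * b); pose v := f (b * a).
pose p := f a * f b; pose q := f b * f a; pose s := f r.
have uv : u + v = p + q by rewrite -raddfD jordan_sym.
have QE : Q = p - v by apply/eqP; rewrite subr_eq addrAC eq_sym subr_eq -uv.
have key : u * s * v + v * s * u = p * s * q + q * s * p.
  rewrite -jordan_triple_sym.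
  have -> : a * b * r * (b * a) + b * a * r * (a * b) =
            a * (b * r * b) * a + b * (a * r * a) * b by rewrite !mulrA.
  by rewrite raddfD !jordan_triple !mulrA.
(* [Q] is replaced by [p - v], while [P] stays [u - p]: with this mixed choice
   the expansion involves only [u + v] and the combination in [key]. *)
rewrite -/s [in X in X + _]QE [in X in _ + X]QE /P -/u -/p.
transitivity ((u + v) * s * p + p * s * (u + v) - (p * s * p) *+ 2
              - (u * s * v + v * s * u)).
  rewrite mulr2n !(mulrBl, mulrBr, mulrDl, mulrDr).
  rewrite !(opprD, opprK) !addrA.
  by rewrite [LHS](ACl (1*8*5*4*2*7*3*6)%AC).
rewrite uv key mulr2n !(mulrDl, mulrDr) !opprD !addrA.
by rewrite [LHS](ACl ((1*5)*(3*6)*(2*8)*(4*7))%AC)/= !subrr !addr0.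
Qed.

End JordanMaps.

(** Apply [f] to [x * x^-1 * x = x] and cancel the two outer factors [f x]. *)
Lemma jordan_inv (S T : unitRingType) (f : {additive S -> T}) (x : S) :
  (forall y : T, y *+ 2 = 0 -> y = 0) ->
  (forall a, f (a ^+ 2) = f a ^+ 2) ->
  x \is a GRing.unit -> f x \is a GRing.unit -> f x^-1 = (f x)^-1.
Proof.
move=> T2 f_sqr xU fxU; apply: (mulIr fxU); apply: (mulrI fxU).
by rewrite mulrA -jordan_triple// divrr// mul1r mulVr// mulr1.
Qed.

(** * Prime rings *)

Section PrimeRings.
Variables (S : pzRingType).
Hypothesis S_prime : prime_ring S.

(** The element [p] lies in the ideal [I] of all [x] with [x S q = 0], the
    element [q] lies in the ideal [J] of all [y] with [I S y = 0], and
    [I J = 0].  Annihilators are used in place of the ideals generated by [p]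
    and [q], since membership in them needs no sums. *)
Lemma prime_ring_elementwise (p q : S) :
  (forall r, p * r * q = 0) -> p = 0 \/ q = 0.
Proof.
move=> pq.
pose I : set S := fun x => forall r, x * r * q = 0.
pose J : set S := fun y => forall x r, I x -> x * r * y = 0.
have idI : two_sided_ideal I.
  split=> [r|x y Ix Iy r|r x Ix s|r x Ix s].
  - by rewrite !mul0r.
  - by rewrite !mulrBl Ix Iy subr0.
  - by rewrite -!mulrA [x * _]mulrA Ix mulr0.
  - by rewrite -mulrA -(mulrA x) (mulrA r) mulrA Ix.
have idJ : two_sided_ideal J.
  split=> [x r Ix|x y Jx Jy w r Iw|r x Jx w s Iw|r x Jx w s Iw].
  - by rewrite mulr0.
  - by rewrite mulrBr Jx// Jy// subr0.
  - by rewrite mulrA -(mulrA w) Jx.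
  - by rewrite mulrA Jx// mul0r.
have Ip : I p by [].
have Jq : J q by move=> x r; apply.
have IJ : ideal_product I J = [set 0]%classic.
  apply/seteqP; split=> [x [n [a [b [Ia Jb ->]]]]|x ->] /=.
    by apply: big1 => i _; rewrite -[a i]mulr1 Jb.
  by exists 0%N, (fun=> 0), (fun=> 0); split=> [[]//|[]//|]; rewrite big_ord0.
have [I0|I0] := pselect (I = [set 0]%classic).
  by left; move: Ip; rewrite I0.
have [J0|J0] := pselect (J = [set 0]%classic).
  by right; move: Jq; rewrite J0.
by case: (S_prime idI idJ I0 J0).
Qed.

(** With [w = p r q], moving the factors [q] past the factors [p] three times
    gives [w s w = - (w s w)], hence [w s w = 0] for all [s].  Primeness then
    gives [w = 0], and, as [r] is arbitrary, [p = 0] or [q = 0]. *)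
Lemma prime_ring_anticommute (p q : S) :
  (forall x : S, x *+ 2 = 0 -> x = 0) ->
  (forall r, p * r * q + q * r * p = 0) -> p = 0 \/ q = 0.
Proof.
move=> S_2free pq; apply: prime_ring_elementwise => r.
have qp s : q * s * p = - (p * s * q).
  by apply/eqP; rewrite -addr_eq0 addrC pq.
suff: p * r * q = 0 \/ p * r * q = 0 by case.
apply: prime_ring_elementwise => s; apply: S_2free.
rewrite mulr2n; apply/eqP; rewrite addr_eq0; apply/eqP.
transitivity (p * r * (q * s * p) * r * q); first by rewrite !mulrA.
transitivity (- (p * (r * p * s) * q) * r * q).
  by rewrite qp !(mulrN, mulNr, mulrA).
transitivity (q * r * p * s * p * r * q); first by rewrite -qp !mulrA.
by rewrite qp !(mulNr, mulrA).
Qed.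

End PrimeRings.

(** A group is not the union of two proper subgroups: if [x] is outside [P] and
    [y] is outside [Q], then [x - y] is in neither. *)
Lemma additive_union_cover (V : zmodType) (P Q : V -> Prop) :
  (forall x y, P x -> P y -> P (x - y)) ->
  (forall x y, Q x -> Q y -> Q (x - y)) ->
  (forall x, P x \/ Q x) -> (forall x, P x) \/ (forall x, Q x).
Proof.
move=> Pb Qb PQ; apply: contrapT => /not_orP[/existsNP[x nPx] /existsNP[y nQy]].
have Qx : Q x by case: (PQ x).
have Py : P y by case: (PQ y).
have [Pxy|Qxy] := PQ (x - y).
  apply: nPx; rewrite -(subrK y x) -[X in _ + X]opprK.
  have P0 : P 0 by rewrite -(subrr y); exact: (Pb).
  have : P (0 - y) by exact: (Pb).
  by rewrite sub0r; exact: Pb.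
by apply: nQy; rewrite -[y](subKr x); exact: Qb.
Qed.

(** Every pair [(a, b)] obeys one of the two rules.  For fixed [a], the elements
    [b] obeying a given rule form a subgroup, and so do the elements [a] obeying
    a given rule with every [b]; the covering lemma is applied at both levels. *)
Lemma jordan_prime (S T : pzRingType) (f : {additive S -> T}) :
  (forall y : T, y *+ 2 = 0 -> y = 0) ->
  (forall a, f (a ^+ 2) = f a ^+ 2) ->
  (forall y, exists x, f x = y) -> prime_ring T ->
  (forall a b, f (a * b) = f a * f b) \/ (forall a b, f (a * b) = f b * f a).
Proof.
move=> T2 f_sqr f_surj T_prime.
pose hom a b := f (a * b) = f a * f b.
pose anti a b := f (a * b) = f b * f a.
have hom_or_anti a b : hom a b \/ anti a b.
  have [r|/eqP|/eqP] := prime_ring_anticommute T_prime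
    (p := f (a * b) - f a * f b) (q := f (a * b) - f b * f a) T2.
  - by have [s <-] := f_surj r; exact: jordan_defects_anticommute.
  - by rewrite subr_eq0 => /eqP; left.
  - by rewrite subr_eq0 => /eqP; right.
apply: additive_union_cover => [a a' Ha Ha' b|a a' Ha Ha' b|a].
- by rewrite mulrBl !raddfB mulrBl Ha Ha'.
- by rewrite mulrBl !raddfB mulrBr Ha Ha'.
- apply: additive_union_cover => [b b' Hb Hb'|b b' Hb Hb'|b].
  + by rewrite mulrBr !raddfB mulrBr Hb Hb'.
  + by rewrite mulrBr !raddfB mulrBl Hb Hb'.
  + exact: hom_or_anti.
Qed.

(** * Invertibility of small perturbations of scalars *)

(** A positive element of [R[i]] is a positive real number, so this is the
    Archimedean property of [R]. *)
Lemma complex_half_expn_lt (R : realType) (e : R[i]) :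
  0 < e -> exists n : nat, 2^-1 ^+ n < e.
Proof.
case: e => a b; rewrite ltcE /= => /andP[/eqP b0 a0].
have [n na] : exists n : nat, 2^-1 ^+ n < a.
  pose n := Num.bound a^-1; exists n.
  rewrite exprVn invf_plt ?posrE// ?exprn_gt0//.
  apply: lt_trans (archi_boundP _) _; first by rewrite invr_ge0 ltW.
  by rewrite -natrX ltr_nat ltn_expl.
exists n.
have -> : (2^-1 : R[i]) = (2^-1)%:C%C.
  by rewrite fmorphV rmorph_nat.
by rewrite -rmorphXn ltcE/= b0 eqxx.
Qed.

(** The hypothesis on [K] is what makes the geometric series of ratio one half
    converge; a general ordered field [K] may have infinitesimals. *)
Section Neumann.
Context {K : numFieldType} {A : unitalBanachAlgType K}.
Hypothesis half_expn_lt : forall e : K, 0 < e -> exists n : nat, 2^-1 ^+ n < e.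
Variable x : A.
Hypothesis x_small : `|x| <= 2^-1.

(** The factor [`|1|] accounts for norms in which the unit does not have norm
    one; it only rescales the estimates. *)
Lemma norm_expn_le n : `|x ^+ n| <= `|1 : A| * 2^-1 ^+ n.
Proof.
elim: n => [|n IH]; first by rewrite !expr0 mulr1.
rewrite !exprSr mulrA (le_trans (normrM_le _ _))//.
by rewrite ler_pM.
Qed.

Let u (n : nat) : A := \sum_(k < n) x ^+ k.

Lemma neumann_dist n m :
  `|u n - u (n + m)| <= `|1 : A| * 2 * 2^-1 ^+ n.
Proof.
(* The sharper bound with a subtracted tail is the one that telescopes. *)
suff : `|u n - u (n + m)| <= `|1 : A| * 2 * (2^-1 ^+ n - 2^-1 ^+ (n + m)).
  move=> /le_trans; apply; rewrite ler_wpM2l ?mulr_ge0//.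
  by rewrite gerBl exprn_ge0.
elim: m => [|m IH]; first by rewrite addn0 !subrr normr0 mulr0.
rewrite addnS /u big_ord_recr /= opprD addrA.
apply: le_trans (ler_normB _ _) _.
apply: le_trans (lerD IH (norm_expn_le _)) _.
rewrite -!mulrA -mulrDr ler_wpM2l// exprSr.
rewrite [in leRHS]mulrBr [_ ^+ (n + m) * _]mulrC mulVKf ?pnatr_eq0//.
by rewrite mulrBr -addrA lerD2l mulr_natl mulr2n opprD addrNK.
Qed.

Lemma neumann_cvg : exists l : A, forall e, 0 < e ->
  exists n0 : nat, forall n, (n0 <= n)%N -> `|l - u n| < e.
Proof.
have : (cvg (u @ \oo))%classic.
  apply: cauchy_cvg; apply: cauchy_exP => e e0.
  have [|n] := @half_expn_lt (e / (`|1 : A| * 2)).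
    by rewrite divr_gt0// mulr_gt0// normr_gt0 oner_eq0.
  rewrite ltr_pdivlMr ?mulr_gt0 ?normr_gt0 ?oner_eq0// mulrC => ne.
  exists (u n); exists n => // m /= nm.
  rewrite -ball_normE /ball_ /= -(subnKC nm).
  exact: le_lt_trans (neumann_dist _ _) ne.
move=> /cvg_ex[l ul]; exists l => e e0.
move/cvgrPdist_lt: ul => /(_ e e0)[n0 _ H].
by exists n0 => n /H.
Qed.

Lemma neumann_unit : 1 - x \is a GRing.unit.
Proof.
have [l ul] := neumann_cvg.
have tele n : u n * (1 - x) = 1 - x ^+ n /\ (1 - x) * u n = 1 - x ^+ n.
  have right : (1 - x) * u n = 1 - x ^+ n.
    by rewrite -opprB mulNr -subrX1 opprB.
  split=> //; rewrite -right; apply/esym/commr_sum => i _.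
  by apply/commrX/commr_sym/commrB; [exact: commr1|].
(* Both [l - u n] and [x ^+ n] become arbitrarily small, so that no nonzero [w]
   can satisfy these bounds. *)
have vanish (w : A) (r : K) : 0 <= r ->
    (forall n, `|w| <= `|l - u n| * r + `|x ^+ n|) -> w = 0.
  move=> r0 H; apply/eqP; rewrite -normr_eq0; apply: contraT => w0.
  have {}w0 : 0 < `|w| by rewrite lt_def w0 /=.
  have [|n0 Hn0] := ul (`|w| / 2 / (1 + r)).
    by rewrite !divr_gt0// ltr_pwDl.
  have [|n1 Hn1] := @half_expn_lt (`|w| / 2 / `|1 : A|).
    by rewrite !divr_gt0// normr_gt0 oner_eq0.
  suff : `|w| < `|w| by rewrite ltxx.
  pose n := maxn n0 n1.
  apply: le_lt_trans (H n) _.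
  rewrite [ltRHS]splitr ler_ltD//.
    have := Hn0 n (leq_maxl _ _).
    rewrite ltr_pdivlMr ?ltr_pwDl// => /ltW; apply: le_trans.
    by rewrite ler_wpM2l// lerDr.
  apply: le_lt_trans (norm_expn_le n) _.
  move: Hn1; rewrite ltr_pdivlMr ?normr_gt0 ?oner_eq0// mulrC.
  apply: le_lt_trans; rewrite ler_wpM2l//.
  by rewrite ler_wiXn2l ?invr_ge0 ?invf_le1 ?ler1n ?leq_maxr.
have lV : l * (1 - x) = 1.
  apply/eqP; rewrite -subr_eq0; apply/eqP/(vanish _ `|1 - x|) => // n.
  have -> : l * (1 - x) - 1 = (l - u n) * (1 - x) - x ^+ n.
    by rewrite mulrBl (tele n).1 opprB addrA addrAC addrK.
  by apply: le_trans (ler_normB _ _) _; rewrite lerD2r normrM_le.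
have Vl : (1 - x) * l = 1.
  apply/eqP; rewrite -subr_eq0; apply/eqP/(vanish _ `|1 - x|) => // n.
  have -> : (1 - x) * l - 1 = (1 - x) * (l - u n) - x ^+ n.
    by rewrite mulrBr (tele n).2 opprB addrA addrAC addrK.
  apply: le_trans (ler_normB _ _) _; rewrite lerD2r mulrC.
  exact: normrM_le.
by apply/unitrP; exists l.
Qed.

End Neumann.

(** Divide by [k] to reduce to [1 - x] with [`|x| <= 2^-1]. *)
Lemma add_scalar_unit (R : realType) (A : unitalBanachAlgType R[i]) (a : A)
  (k : R[i]) : k != 0 -> `|a| * 2 <= `|k| -> a + k%:A \is a GRing.unit.
Proof.
move=> k0 ak.
have -> : a + k%:A = k *: (1 - - (k^-1 *: a)).
  by rewrite scalerBr scalerN opprK scalerA mulfV// scale1r addrC.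
rewrite scaler_unit ?unitfE//; apply: neumann_unit.
  exact: complex_half_expn_lt.
rewrite normrN normrZ normfV ler_pdivrMl ?normr_gt0//.
by rewrite ler_pdivlMr.
Qed.

(** * Linear maps compatible with inversion *)

(** The map [g] carries the resolvent identity from [A] to [B], where it is
    compared with the resolvent identity of [f a] and [f (a + k)].  Two maps
    occur because a product prescribed at [c] relates [phi x] to
    [phi (x^-1 * c)] rather than to [phi x^-1]. *)
Lemma inv_preserving_sqr (K : fieldType) (A B : unitAlgType K)
    (f g : {linear A -> B}) (a : A) (k : K) :
  f 1 = 1 ->
  (forall x, x \is a GRing.unit ->
     f x \is a GRing.unit /\ g x^-1 = (f x)^-1) ->
  k != 0 -> a \is a GRing.unit -> a + k%:A \is a GRing.unit ->
  f (a ^+ 2) = f a ^+ 2.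
Proof.
move=> f1 fg k0 au bu; pose b := a + k%:A.
have fb : f b = f a + k%:A by rewrite linearD linearZ /= f1.
have [fau ga] := fg a au; have [fbu gb] := fg b bu.
have resolvent (U : unitAlgType K) (s t : U) : s \is a GRing.unit ->
    t \is a GRing.unit -> t = s + k%:A -> s^-1 - t^-1 = k *: (t * s)^-1.
  move=> su tu ts; rewrite invrM//.
  have -> : s^-1 - t^-1 = s^-1 * (t - s) * t^-1.
    by rewrite mulrBr mulVr// mulrBl mulrK// mul1r.
  by rewrite ts addrC addKr -scalerAr mulr1 -scalerAl.
have bau : b * a \is a GRing.unit by rewrite unitrMl.
have [_ gba] := fg _ bau.
have : f (b * a) = f b * f a.
  apply: invr_inj; apply: (scalerI k0).
  by rewrite -resolvent// -ga -gb -linearB resolvent// linearZ /= gba.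
rewrite fb /b !mulrDl linearD -!expr2 -!scalerAl !mul1r linearZ /=.
exact: addIr.
Qed.

(** Adding a scalar changes both sides by the same terms; thus the identity for
    an invertible translate of [a] suffices. *)
Lemma sqr_shift (K : pzRingType) (A B : algType K) (f : {linear A -> B})
    (a : A) (k : K) :
  f 1 = 1 -> f ((a + k%:A) ^+ 2) = f (a + k%:A) ^+ 2 -> f (a ^+ 2) = f a ^+ 2.
Proof.
move=> f1; rewrite linearD linearZ /= f1 !expr2 !mulrDl !mulrDr.
rewrite -!(scalerAl, scalerAr) !(mul1r, mulr1) !linearD /= !linearZ /= f1.
by move=> /addIr /addIr.
Qed.

(** * Maps sending factorizations of one element to factorizations of a unit *)

Section FixedProduct.
Variables (A B : unitRingType) (c : A) (d : B) (phi : A -> B).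
Hypothesis d_unit : d \is a GRing.unit.
Hypothesis phi_prod : forall a b : A, a * b = c -> phi a * phi b = d.

(** A right inverse comes from [x * (x^-1 * c) = c], a left inverse from
    [(c / x) * x = c]. *)
Lemma fixed_product_unit x : x \is a GRing.unit -> phi x \is a GRing.unit.
Proof.
move=> xu.
have xr : phi x * (phi (x^-1 * c) / d) = 1.
  by rewrite mulrA phi_prod ?mulVKr// divrr.
have xl : d^-1 * phi (c / x) * phi x = 1.
  by rewrite -mulrA phi_prod ?divrK// mulVr.
apply/unitrP; exists (phi (x^-1 * c) / d); split=> //.
by rewrite -[X in X * _]mul1r -xl -(mulrA _ (phi x)) xr mulr1.
Qed.

Lemma fixed_product_inv x : x \is a GRing.unit ->
  phi (x^-1 * c) = (phi x)^-1 * d.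
Proof.
move=> xu; rewrite -[LHS](mulKr (fixed_product_unit xu)).
by rewrite phi_prod// mulVKr.
Qed.

End FixedProduct.

Theorem theorem4p1 (R : realType) (A B : unitalBanachAlgType R[i])
    (c : A) (d : B) (phi : {linear A -> B})
    (d_unit : d \is a GRing.unit)
    (phi_bij : bijective phi)
    (phi_prod : forall a b : A, a * b = c -> phi a * phi b = d) :
  let z := phi 1 in
  let psi := fun x : A => z^-1 * phi x in
  z \is a GRing.unit /\
  [/\ forall x : A, x \is a GRing.unit ->
        phi x \is a GRing.unit /\ phi x^-1 = z * (phi x)^-1 * z,
      strongly_preserves_invertibility psi,
      jordan_homomorphism psi
    & prime_ring B ->
        algebra_homomorphism psi \/ algebra_antihomomorphism psi].
Proof.
move=> z psi.
have phiU x : x \is a GRing.unit -> phi x \is a GRing.unit.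
  exact: (fixed_product_unit d_unit phi_prod).
have zU : z \is a GRing.unit by apply: phiU; exact: unitr1.
have psi_lin : linear psi.
  by move=> k x y; rewrite /psi linearP mulrDr scalerAr.
(* The factor [d^-1 * z] turns [phi (x^-1 * c) = (phi x)^-1 * d] into
   [(phi x)^-1 * z], the inverse of [psi x]. *)
pose g := fun y : A => phi (y * c) * (d^-1 * z).
have g_lin : linear g.
  by move=> k x y; rewrite /g mulrDl -scalerAl linearP mulrDl scalerAl.
pose f : {linear A -> B} :=
  HB.pack psi (GRing.isLinear.Build _ _ _ _ psi psi_lin).
pose g' : {linear A -> B} :=
  HB.pack g (GRing.isLinear.Build _ _ _ _ g g_lin).
have psi1 : psi 1 = 1 by rewrite /psi mulVr.
have psiU x : x \is a GRing.unit -> psi x \is a GRing.unit.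
  by move=> xU; rewrite unitrMl ?phiU// unitrV.
have fg x : x \is a GRing.unit -> f x \is a GRing.unit /\ g' x^-1 = (f x)^-1.
  move=> xU; split; first exact: psiU.
  rewrite /f /g' /= /g /psi (fixed_product_inv d_unit phi_prod)//.
  by rewrite mulrA mulrK// invrM ?unitrV ?zU ?phiU// invrK.
have psi_sqr a : f (a ^+ 2) = f a ^+ 2.
  pose M : R[i] := `|a| * 2 + 1.
  have M0 : 0 < M by rewrite ltr_wpDl ?mulr_ge0.
  have aM l : M <= l -> a + l%:A \is a GRing.unit.
    move=> Ml; have l0 := lt_le_trans M0 Ml.
    apply: add_scalar_unit; first by rewrite gt_eqF.
    by rewrite (gtr0_norm l0) (le_trans _ Ml)// lerDl.
  (* The resolvent identity is used at the invertible elements [a + M] and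
     [a + 2 M]. *)
  have bU := aM M (lexx _).
  have := @inv_preserving_sqr _ A B f g' (a + M%:A) M psi1 fg _ bU.
  rewrite gt_eqF// -addrA -scalerDl => /(_ isT); rewrite aM ?lerDl ?ltW//.
  by move=> /(_ isT); exact: sqr_shift.
have B2 (x : B) : x *+ 2 = 0 -> x = 0.
  by move=> /eqP; rewrite -scaler_nat scaler_eq0 pnatr_eq0 => /eqP.
have f_jordan_inv x : x \is a GRing.unit -> psi x^-1 = (psi x)^-1.
  by move=> xU; exact: (jordan_inv (f := f) B2 psi_sqr xU (psiU x xU)).
split=> //; split.
- move=> x xU; split; first exact: phiU.
  have /(congr1 ( *%R z)) := f_jordan_inv x xU.
  by rewrite /psi mulVKr// invrM ?unitrV ?zU ?phiU// invrK mulrA.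
- by move=> x xU; split; [exact: psiU|exact: f_jordan_inv].
- by [].
- move=> B_prime.
  have f_surj y : exists x, f x = y.
    have [phiV _ phiK] := phi_bij; exists (phiV (z * y)).
    by rewrite /f /= /psi phiK mulKr.
  by have [H|H] := jordan_prime (f := f) B2 psi_sqr f_surj B_prime; [left|right].
Qed.
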